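(* Let $(\bar{A},\bar{B})$ be a structural pair, where $\bar{A}\in\{0,\star\}^{n\times n}$ is symmetrically structured with term rank $\mathrm{t\text{-}rank}(\bar{A})=k$ and $\bar{B}\in\{0,\star\}^{n\times m}$ is a structured matrix. If $(\bar{A},\bar{B})$ is irreducible, then there exists a proper variety $V\subset\mathbb{R}^{n_{\bar{A}}+n_{\bar{B}}}$ such that for every numerical realization $(\tilde{A},\tilde{B})$ with $[\mathbf{p}_{\tilde{A}},\mathbf{p}_{\tilde{B}}]\in\mathbb{R}^{n_{\bar{A}}+n_{\bar{B}}}\setminus V$, $\tilde{A}$ has $k$ nonzero, simple and controllable modes.
   Context: A structured matrix is a matrix each of whose entries is either a fixed zero or an independent free real parameter, denoted $\star$. A matrix $\bar{A}\in\{0,\star\}^{n\times n}$ is symmetrically structured if $[\bar{A}]_{ij}=\star$ if and only if $[\bar{A}]_{ji}=\star$, with the parameter at $(i,j)$ constrained to take the same value as the one at $(j,i)$ and the parameters otherwise independent. $n_{\bar{M}}$ is the number of independent free parameters of $\bar{M}$. A numerical realization $\tilde{M}$ is obtained by assigning real numbers to the independent free parameters of $\bar M$, and $\mathbf{p}_{\tilde{M}}\in\mathbb{R}^{n_{\bar{M}}}$ is the vector of assigned values; the parameters of $\bar{A}$ and $\bar{B}$ are independent of each other. The term rank $\mathrm{t\text{-}rank}(\bar{A})$ is the largest integer $k$ such that there are distinct rows $i_1,\dots,i_k$ and distinct columns $j_1,\dots,j_k$ with $[\bar{A}]_{i_\ell j_\ell}=\star$ for all $\ell$. A variety in $\mathbb{R}^N$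 is the set of common zeros in $\mathbb{R}^N$ of finitely many real polynomials; it is proper if it is not all of $\mathbb{R}^N$. The pair $(\bar{A},\bar{B})$ is reducible if there exist a permutation matrix $P$ and an integer $1\le q\le n$ such that $P\bar{A}P^{-1}=\begin{bmatrix} A_{11} & \mathbf{0} \\ A_{21} & A_{22} \end{bmatrix}$ and $P\bar{B}=\begin{bmatrix} \mathbf{0} \\ B_2 \end{bmatrix}$, where $A_{11}$ is $q\times q$, $B_2$ has $n-q$ rows, and $\mathbf{0}$ denotes blocks of fixed zeros (for $q=n$ this means $\bar{B}=\mathbf{0}$); it is irreducible otherwise. A mode of $\tilde{A}$ is a pair $(\lambda,e)$ with $\lambda\in\mathbb{C}$, $e\in\mathbb{C}^n\setminus\{0\}$ and $e^\top\tilde{A}=\lambda e^\top$; it is nonzero if $\lambda\neq0$, simple if $\lambda$ is a simple eigenvalue of $\tilde{A}$, uncontrollable if $e^\top\tilde{B}=0$, and controllable otherwise. ''Has $k$ nonzero, simple and controllable modes'' means that $\tilde{A}$ has $k$ nonzero simple eigenvalues whose modes are all controllable. *)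

(* Defs.v *)
From mathcomp Require Import all_boot all_order all_fingroup all_algebra.
From mathcomp Require Import reals complex mpoly.

Set Implicit Arguments.
Unset Strict Implicit.
Unset Printing Implicit Defensive.

Import GRing.Theory.
Local Open Scope ring_scope.

(* The entry [true] stands for a free parameter, [false] for a fixed zero. *)
Definition structured (m n : nat) : Type := 'M[bool]_(m, n).

Definition symmetrically_structured (n : nat) (A : structured n n) : Prop :=
  forall i j : 'I_n, A i j = A j i.

(* Positions carrying the independent free parameters; in the symmetric case
   the positions (i, j) and (j, i) share a parameter, represented by i <= j. *)
Definition free_pos (m n : nat) (M : structured m n) : {set 'I_m * 'I_n} :=
  [set x | M x.1 x.2].

Definition sym_free_pos (n : nat) (A : structured n n) : {set 'I_n * 'I_n} :=
  [set x | A x.1 x.2 & (x.1 <= x.2)%N].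

Definition entries_at (R : Type) (m n : nat) (S : {set 'I_m * 'I_n})
    (M : 'M[R]_(m, n)) : 'rV[R]_#|S| :=
  \row_k M (enum_val k).1 (enum_val k).2.

Definition realization (R : realType) (m n : nat) (M : structured m n)
    (Mt : 'M[R]_(m, n)) : Prop :=
  forall i j, M i j = false -> Mt i j = 0.

Definition sym_realization (R : realType) (n : nat) (A : structured n n)
    (At : 'M[R]_n) : Prop :=
  realization A At /\ At^T = At.

Definition has_transversal (m n : nat) (M : structured m n) : pred nat :=
  fun k => [exists r : {ffun 'I_k -> 'I_m}, exists c : {ffun 'I_k -> 'I_n},
    [&& injectiveb r, injectiveb c & [forall l, M (r l) (c l)]]].

Lemma has_transversal0 (m n : nat) (M : structured m n) :
  exists k, has_transversal M k.
Proof.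
exists 0%N; apply/existsP; exists (ffun0 (card_ord 0)).
apply/existsP; exists (ffun0 (card_ord 0)).
by apply/and3P; split; [apply/injectiveP | apply/injectiveP | apply/forallP];
  case.
Qed.

Lemma has_transversal_le (m n : nat) (M : structured m n) (k : nat) :
  has_transversal M k -> (k <= m)%N.
Proof.
case/existsP=> r /existsP[c /and3P[/injectiveP r_inj _ _]].
by have := leq_card r r_inj; rewrite !card_ord.
Qed.

Definition term_rank (m n : nat) (M : structured m n) : nat :=
  ex_maxn (has_transversal0 M) (@has_transversal_le m n M).

(* [row_perm s (col_perm s A)] is P A P^-1 and [row_perm s B] is P B for the
   permutation matrix P = perm_mx s (see row_permE and col_permE). *)
Definition reducible (n m : nat) (A : structured n n) (B : structured n m)
    : Prop :=
  exists (s : 'S_n) (q : nat),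
    [/\ (1 <= q <= n)%N,
        forall i j : 'I_n, (i < q)%N -> (q <= j)%N ->
          row_perm s (col_perm s A) i j = false
      & forall (i : 'I_n) (j : 'I_m), (i < q)%N -> row_perm s B i j = false].

Definition irreducible (n m : nat) (A : structured n n) (B : structured n m)
    : Prop :=
  ~ reducible A B.

Definition variety (R : realType) (N : nat) (V : 'rV[R]_N -> Prop) : Prop :=
  exists ps : seq {mpoly R[N]},
    forall x, V x <-> (forall p, p \in ps -> p.@[x 0] = 0).

Definition proper_variety (R : realType) (N : nat) (V : 'rV[R]_N -> Prop)
    : Prop :=
  variety V /\ ~ (forall x, V x).

Definition complexify (R : realType) (m n : nat) (M : 'M[R]_(m, n))
    : 'M[R[i]]_(m, n) :=
  map_mx (real_complex R) M.

Definition mode (R : realType) (n : nat) (A : 'M[R]_n) (l : R[i])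
    (e : 'cV[R[i]]_n) : Prop :=
  e != 0 /\ e^T *m complexify A = l *: e^T.

Definition uncontrollable (R : realType) (n m : nat) (B : 'M[R]_(n, m))
    (e : 'cV[R[i]]_n) : Prop :=
  e^T *m complexify B = 0.

(* Algebraic multiplicity one; in particular [l] is an eigenvalue. *)
Definition simple_eigenvalue (R : realType) (n : nat) (A : 'M[R]_n)
    (l : R[i]) : Prop :=
  mup l (char_poly (complexify A)) = 1%N.

Definition has_nonzero_simple_controllable_modes (R : realType) (n m : nat)
    (A : 'M[R]_n) (B : 'M[R]_(n, m)) (k : nat) : Prop :=
  exists ls : seq R[i],
    [/\ uniq ls, size ls = k
      & forall l, l \in ls ->
          [/\ l != 0, simple_eigenvalue A l
            & forall e, mode A l e -> ~ uncontrollable B e]].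

(* Main.v *)
Require Import Defs.
From mathcomp Require Import all_boot all_order all_fingroup all_algebra.
From mathcomp Require Import reals complex mpoly.
From mathcomp Require Import boolp ring zify.

Set Implicit Arguments.
Unset Strict Implicit.
Unset Printing Implicit Defensive.

Import Order.TTheory GRing.Theory Num.Theory.
Local Open Scope ring_scope.

(* Call a realization M of a symmetric pattern maximal for a matrix W if the
   Krylov family W, M W, M^2 W, ... spans the largest dimension possible in the
   pattern; this holds outside a proper variety.  Moving along M + t M' inside
   the pattern cannot raise the dimension, so a relation m_t(M + t M') W = 0 of
   minimal degree holds with coefficients polynomial in t; its first-order term
   in t, paired with an eigenvector e of M for l, says that
   e M' h(M) W is proportional to e W, where m_0(X) = m_0(l) + (X - l) h(X).
   - W = 1: if a nonzero eigenvalue l had an eigenspace E of dimension >= 2,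
     letting M' run over the symmetric elementary directions of the pattern
     would give w_i w_j = 0 for all w in E and all free (i, j), hence
     l |w|^2 = w M w^T = 0.
   - W = delta_s: the support of an eigenvector with l <> 0 is closed under
     adjacency in the graph of the pattern.
   The second point is applied to H = [[A, B], [B^T, 0]]: an uncontrollable
   mode e of A is an eigenvector (e, 0) of H, so its support witnesses
   reducibility.  The generic rank of A is the term rank, and for a real
   symmetric matrix with simple nonzero eigenvalues the rank counts them. *)

(** * Krylov families and their cofactor relation *)

Definition krylov (S : comNzRingType) (n d : nat) (M W : 'M[S]_n.+1) :
    'M[S]_(d, n.+1 * n.+1) :=
  \matrix_(i < d) mxvec (M ^+ i *m W).

(* The cofactor relation among W, M W, ..., M^d W, where C selects d
   combinations of the matrix entries. *)
Definition krylov_poly (S : comNzRingType) (n d : nat) (M W : 'M[S]_n.+1)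
    (C : 'M[S]_(n.+1 * n.+1, d)) : {poly S} :=
  \sum_(i < d.+1)
    ((-1) ^+ (i + d) * \det (row' i (krylov d.+1 M W *m C))) *: 'X^i.

Lemma krylov_map (S S' : comNzRingType) (f : {rmorphism S -> S'}) n d
    (M W : 'M[S]_n.+1) :
  map_mx f (krylov d M W) = krylov d (map_mx f M) (map_mx f W).
Proof.
apply/matrixP=> i j; case/mxvec_indexP: j => a b.
rewrite mxE /krylov [in LHS]mxE [in RHS]mxE !mxvecE.
by rewrite -rmorphXn -map_mxM [in RHS]mxE.
Qed.

Lemma krylov_poly_map (S S' : comNzRingType) (f : {rmorphism S -> S'}) n d
    (M W : 'M[S]_n.+1) C :
  map_poly f (krylov_poly M W C) =
  krylov_poly (d := d) (map_mx f M) (map_mx f W) (map_mx f C).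
Proof.
rewrite /krylov_poly rmorph_sum; apply: eq_bigr => i _ /=.
rewrite map_polyZ map_polyXn rmorphM /= rmorphXn /= rmorphN1 -det_map_mx.
rewrite -krylov_map -map_mxM; congr (_ * \det _ *: _).
by apply/matrixP=> x y; rewrite !mxE.
Qed.

(** Laplace expansion along the last column: the unit column adjoined to [C] reads off the entry
    [(a, b)] of each [M ^+ i *m W], and its cofactors are the coefficients of [krylov_poly]. *)
Lemma det_krylov_col (S : comNzRingType) n d (M W : 'M[S]_n.+1) C
    (a b : 'I_n.+1) :
  (horner_mx M (krylov_poly (d := d) M W C) *m W) a b =
  \det (krylov d.+1 M W *m
     (\matrix_(i, l) oapp (C i) (i == mxvec_index a b)%:R (unlift ord_max l))).
Proof.
rewrite (expand_det_col _ ord_max) /krylov_poly rmorph_sum mulmx_suml summxE.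
apply: eq_bigr => i _.
rewrite /cofactor /= horner_mxZ rmorphXn /= horner_mx_X -scalemxAl mxE mulrC.
congr (_ * _).
  rewrite [RHS]mxE (bigD1 (mxvec_index a b)) //= big1 ?addr0.
    by rewrite [X in X * _]mxE mxvecE [X in _ * X]mxE unlift_none /= eqxx mulr1.
  by move=> j /negbTE jab; rewrite [X in _ * X]mxE unlift_none /= jab mulr0.
congr (_ * _); apply: congr1; apply/matrixP=> x y; rewrite !mxE.
by apply: eq_bigr => j _; rewrite !mxE liftK.
Qed.

(** Dependence is expressed by determinants instead of a rank, so that the lemma applies over the
    polynomial ring in the perturbation parameter. *)
Lemma krylov_poly_annihilates (S : comNzRingType) n d (M W : 'M[S]_n.+1)
    (C : 'M[S]_(n.+1 * n.+1, d)) :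
  (forall X : 'M[S]_(n.+1 * n.+1, d.+1), \det (krylov d.+1 M W *m X) = 0) ->
  horner_mx M (krylov_poly M W C) *m W = 0.
Proof.
by move=> det0; apply/matrixP=> a b; rewrite det_krylov_col det0 mxE.
Qed.

Lemma det_mul_not_free (F : fieldType) d q (K : 'M[F]_(d, q)) (X : 'M_(q, d)) :
  ~~ row_free K -> \det (K *m X) = 0.
Proof.
apply: contraNeq; rewrite -unitfE -unitmxE -row_free_unit /row_free => /eqP KX.
by rewrite eqn_leq rank_leq_row -{1}KX mxrankM_maxl.
Qed.

(** Deleting the last row leaves [krylov d M W *m C], so the coefficient of ['X^d] is 1 up to
    sign. *)
Lemma size_krylov_poly (F : fieldType) n d (M W : 'M[F]_n.+1) C :
  krylov d M W *m C = 1%:M -> size (krylov_poly M W C) = d.+1.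
Proof.
move=> KC; rewrite /krylov_poly big_ord_recr /=.
rewrite [X in \det X](_ : _ = 1%:M); last first.
  rewrite -KC; apply/matrixP=> x y; rewrite !mxE; apply: eq_bigr => j _.
  by congr (_ * _); rewrite !mxE lift_max.
rewrite det1 mulr1 addrC size_polyDl size_scale ?signr_eq0 ?size_polyXn //.
rewrite ltnS; apply: leq_trans (size_sum _ _ _) _.
apply/bigmax_leqP => i _; apply: leq_trans (size_scale_leq _ _) _.
by rewrite size_polyXn.
Qed.

Lemma poly_neq0_eval (F : numDomainType) (p : {poly F}) :
  p != 0 -> exists t, p.[t] != 0.
Proof.
move=> pN0; have := @max_poly_roots _ p [seq i%:R | i <- iota 0 (size p)] pN0.
rewrite map_inj_uniq ?iota_uniq => [|i j /eqP]; last by rewrite eqr_nat => /eqP.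
rewrite size_map size_iota ltnn; case: allP => [_ /(_ isT isT) //|H _].
by have /allPn[t _ tN0] : ~~ all (root p) [seq i%:R | i <- iota 0 (size p)];
  [apply/allP | exists t].
Qed.

Lemma poly_eq0_eval (F : numDomainType) (p : {poly F}) :
  (forall t, p.[t] = 0) -> p = 0.
Proof.
move=> p0; apply/eqP; apply/negPn/negP => /poly_neq0_eval[t].
by rewrite p0 eqxx.
Qed.

(** Let [m_t = a(t) + h_t(X) (X - l)] be the cofactor polynomial of [M + t M']. Since
    [e (M + t M' - l) = t e M'], multiplying [m_t(M + t M') W = 0] by [e] gives
    [a(t) e W + t e M' h_t(M + t M') W = 0]. The coefficient of [t] yields the claim with
    [rho = - a'(0)], the same for every [e]. *)
Lemma first_order (R : numFieldType) n d (M W M' : 'M[R]_n.+1)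
    (C : 'M[R]_(n.+1 * n.+1, d)) (m := krylov_poly M W C) l h :
  (forall t, ~~ row_free (krylov d.+1 (M + t *: M') W)) ->
  m = m.[l]%:P + h * ('X - l%:P) ->
  exists rho, forall e : 'rV_n.+1, e *m M = l *: e ->
    e *m M' *m horner_mx M h *m W = rho *: (e *m W).
Proof.
move=> hnf hm.
pose up q r := @map_mx _ {poly R} (@polyC R) q r.
pose Mt := up _ _ M + 'X *: up _ _ M'.
pose mt := krylov_poly Mt (up _ _ W) (up _ _ C).
have upK q r t (X : 'M[R]_(q, r)) : map_mx (horner_eval t) (up _ _ X) = X.
  by apply/matrixP=> i j; rewrite !mxE /horner_eval hornerC.
have evMt t : map_mx (horner_eval t) Mt = M + t *: M'.
  rewrite /Mt map_mxD map_mxZ !upK; congr (_ + _ *: _).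
  by rewrite /= /horner_eval hornerX.
(* A determinant that vanishes at every value of [t] is the zero polynomial, so the dependence
   passes to the polynomial ring. *)
have mtW : horner_mx Mt mt *m up _ _ W = 0.
  apply: krylov_poly_annihilates => X; apply: poly_eq0_eval => t.
  rewrite -/(horner_eval t _) -det_map_mx map_mxM krylov_map evMt upK.
  exact: det_mul_not_free.
have mt0 : map_poly (horner_eval 0) mt = m.
  by rewrite krylov_poly_map evMt !upK scale0r addr0.
have /factor_theorem[ht] : root (mt - mt.[l%:P]%:P) l%:P.
  by rewrite rootE hornerD hornerN hornerC subrr.
move/eqP; rewrite subr_eq addrC => /eqP hmt.
pose a := mt.[l%:P].
have a0 : a.[0] = m.[l].
  rewrite -/(horner_eval 0 a) /a -horner_map /= mt0.
  by rewrite /horner_eval hornerC.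
have h0 : map_poly (horner_eval 0) ht = h.
  have := hm; rewrite -mt0 {1}hmt rmorphD rmorphM rmorphB /= map_polyX.
  rewrite !map_polyC /= /horner_eval hornerC -[mt.[_]]/a a0 mt0.
  move=> /addrI /mulIf; apply.
  by rewrite polyXsubC_eq0.
(* [mu] is the difference quotient of [a] at 0, so [mu.[0]] is the derivative [a'(0)]. *)
have /factor_theorem[mu] : root (a - a.[0]%:P) 0.
  by rewrite rootE hornerD hornerN hornerC subrr.
rewrite subr0 => /eqP; rewrite subr_eq => /eqP amu.
exists (- mu.[0]) => e eM.
pose et := up _ _ e.
have etMt : et *m (Mt - l%:P%:M) = 'X *: (et *m up _ _ M').
  rewrite mulmxBr mulmxDr -map_mxM eM map_mxZ mul_mx_scalar.
  by rewrite addrAC subrr add0r scalemxAr.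
have key : a *: (et *m up _ _ W) +
           'X *: (et *m up _ _ M' *m horner_mx Mt ht *m up _ _ W) = 0.
  have := congr1 (mulmx et) mtW.
  rewrite mulmx0 => <-.
  rewrite hmt rmorphD mulrC rmorphM /= rmorphB /= horner_mx_X !horner_mx_C.
  rewrite mulmxDl mulmxDr mul_scalar_mx -scalemxAr.
  by rewrite -mulmxE !mulmxA etMt !scalemxAl.
have key0 : m.[l] *: (e *m W) = 0.
  have := congr1 (map_mx (horner_eval 0)) key.
  rewrite map_mxD !map_mxZ map_mxM !upK map_mx0.
  by rewrite /= /horner_eval hornerX scale0r addr0 a0.
have key1 : mu *: (et *m up _ _ W) +
           et *m up _ _ M' *m horner_mx Mt ht *m up _ _ W = 0.
  apply/eqP; have := key; rewrite amu scalerDl a0.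
  rewrite -map_mxM -(map_mxZ (@polyC R)) key0 map_mx0 addr0 mulrC -scalerA.
  by rewrite -scalerDr => /eqP; rewrite scalemx_eq0 polyX_eq0.
have := congr1 (map_mx (horner_eval 0)) key1.
rewrite map_mxD map_mxZ !map_mxM !upK map_mx0 map_horner_mx evMt h0.
rewrite scale0r addr0 => /eqP; rewrite addrC addr_eq0 => /eqP ->.
by rewrite scaleNr.
Qed.

(** * Maximal realizations *)

Lemma eigenvector_horner (F : fieldType) n (M : 'M[F]_n.+1) l (e : 'rV_n.+1) p :
  e *m M = l *: e -> e *m horner_mx M p = p.[l] *: e.
Proof.
move=> eM; elim/poly_ind: p => [|p c IHp].
  by rewrite rmorph0 mulmx0 horner0 scale0r.
rewrite rmorphD rmorphM /= horner_mx_X horner_mx_C mulmxDr mul_mx_scalar.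
by rewrite -mulmxE mulmxA IHp -scalemxAl eM scalerA -scalerDl !hornerE.
Qed.

Lemma krylov_free_annihilator (F : fieldType) n d (M W : 'M[F]_n.+1)
    (h : {poly F}) :
  row_free (krylov d M W) -> (size h <= d)%N -> horner_mx M h *m W = 0 -> h = 0.
Proof.
move=> Kfree szh hMW; apply/polyP => i; rewrite coef0.
have [id|di] := ltnP i d; last by rewrite nth_default // (leq_trans szh).
suff /rowP/(_ (Ordinal id)) : \row_(i < d) h`_i = 0 by rewrite !mxE.
apply: (row_free_inj Kfree); rewrite mul0mx mulmx_sum_row.
have hE : h = \sum_(i < d) h`_i *: 'X^i.
  apply/polyP => k; rewrite -(poly_def d (fun i => h`_i)) coef_poly.
  by case: ltnP => // dk; rewrite nth_default // (leq_trans szh).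
transitivity (mxvec (horner_mx M h *m W)); last by rewrite hMW linear0.
rewrite [in RHS]hE rmorph_sum mulmx_suml linear_sum /=; apply: eq_bigr => j _.
rewrite rowK mxE horner_mxZ -scalemxAl linearZ /=.
by rewrite rmorphXn /= horner_mx_X.
Qed.

Lemma sym_realizationD (R : realType) n (A : structured n n)
    (M M' : 'M[R]_n) (t : R) :
  sym_realization A M -> sym_realization A M' ->
  sym_realization A (M + t *: M').
Proof.
case=> [zM sM] [zM' sM']; split=> [i j Aij|].
  by rewrite !mxE zM // zM' // mulr0 addr0.
by rewrite linearD linearZ /= sM sM'.
Qed.

Definition sym_delta_mx (R : realType) n (i j : 'I_n) : 'M[R]_n :=
  delta_mx i j + delta_mx j i.

Lemma sym_realization_delta (R : realType) n (A : structured n n) i j :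
  symmetrically_structured A -> A i j -> sym_realization A (sym_delta_mx R i j).
Proof.
move=> Asym Aij; split=> [x y Axy|]; last first.
  by rewrite /sym_delta_mx linearD /= !trmx_delta addrC.
rewrite !mxE; case: (x =P i) => [xi|_]; case: (y =P j) => [yj|_] /=.
- by rewrite xi yj Aij in Axy.
- case: (x =P j) => [xj|_] /=; last by rewrite addr0.
  case: (y =P i) => [yi|_]; last by rewrite addr0.
  by rewrite xj yi Asym Aij in Axy.
- case: (x =P j) => [xj|_] /=; last by rewrite addr0.
  case: (y =P i) => [yi|_]; last by rewrite addr0.
  by rewrite xj yi Asym Aij in Axy.
- case: (x =P j) => [xj|_] /=; last by rewrite addr0.
  case: (y =P i) => [yi|_]; last by rewrite addr0.
  by rewrite xj yi Asym Aij in Axy.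
Qed.

Lemma mul_sym_delta_mx (R : realType) n (i j : 'I_n)
    (u : 'rV[R]_n) (w : 'cV_n) :
  (u *m sym_delta_mx R i j *m w) 0 0 = u 0 i * w j 0 + u 0 j * w i 0.
Proof.
have D (a b : 'I_n) : (u *m delta_mx a b *m w) 0 0 = u 0 a * w b 0.
  rewrite -(mul_delta_mx (0 : 'I_1)) mulmxA -colE -mulmxA -rowE.
  by rewrite !mxE big_ord1 !mxE.
by rewrite mulmxDr mulmxDl mxE !D.
Qed.

Lemma dotmx_eq0 (R : realType) n (u : 'rV[R]_n) : (u *m u^T) 0 0 = 0 -> u = 0.
Proof.
rewrite mxE => /eqP; rewrite psumr_eq0 => [/allP u0|i _]; last first.
  by rewrite mxE -expr2 sqr_ge0.
apply/rowP => i; rewrite mxE; apply/eqP.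
by have := u0 i (mem_index_enum i); rewrite mxE mulf_eq0 orbb.
Qed.

(** The second clause ranges over the whole pattern so that it holds all along a line
    [M + t *: M']. *)
Definition krylov_maximal (R : realType) n (A : structured n.+1 n.+1) d
    (M W : 'M[R]_n.+1) : Prop :=
  row_free (krylov d M W) /\
  forall M', sym_realization A M' -> ~~ row_free (krylov d.+1 M' W).

(** [(N P)^T (N P) = P^T N N P = 0], and the real dot product is definite. This rules out multiple
    roots of minimal annihilators of symmetric matrices. *)
Lemma sym_ker_sq (R : realType) n (N P : 'M[R]_n) :
  N^T = N -> N *m (N *m P) = 0 -> N *m P = 0.
Proof.
move=> Nsym NNP; apply: trmx_inj; rewrite trmx0; apply/row_matrixP => i.
rewrite row0; apply: dotmx_eq0.
have QQ : (N *m P)^T *m (N *m P) = 0.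
  by rewrite trmx_mul Nsym -!mulmxA NNP mulmx0.
rewrite tr_row trmxK; move/matrixP/(_ i i): QQ; rewrite [RHS]mxE => <-.
by rewrite !mxE; apply: eq_bigr => j _; rewrite !mxE.
Qed.

Lemma trmx_horner (F : fieldType) n (M : 'M[F]_n.+1) p :
  M^T = M -> (horner_mx M p)^T = horner_mx M p.
Proof.
move=> Msym; elim/poly_ind: p => [|p c IHp]; first by rewrite rmorph0 trmx0.
rewrite rmorphD rmorphM /= horner_mx_X horner_mx_C linearD /= tr_scalar_mx.
rewrite -mulmxE trmx_mul IHp Msym; congr (_ + _).
exact/esym/comm_horner_mx/comm_mx_refl.
Qed.

Lemma factor_size (F : fieldType) d (m h : {poly F}) l :
  size m = d.+1 -> m = h * ('X - l%:P) -> h != 0 /\ size h = d.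
Proof.
move=> szm hm.
have hN0 : h != 0.
  by apply: contra_eq_neq szm => h0; rewrite hm h0 mul0r size_poly0.
split=> //; apply: succn_inj.
by rewrite -szm hm size_Mmonic ?monicXsubC // size_XsubC addn2.
Qed.

(** On the eigenspace, the first-order relation in the direction [sym_delta_mx R i j] reads
    [h(l) (e_i w_j + e_j w_i) = rho <e, w>]. In dimension at least 2 this forces [rho = 0], and
    [e = w] then gives [w_i w_j = 0]. *)
Lemma maximal_eigenspace (R : realType) n (A : structured n.+1 n.+1) d
    (M : 'M[R]_n.+1) l :
  symmetrically_structured A -> sym_realization A M ->
  krylov_maximal A d M 1%:M -> l != 0 -> (\rank (eigenspace M l) <= 1)%N.
Proof.
move=> Asym AM [Kfree Kmax] lN0; rewrite leqNgt; apply/negP => rk2.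
have [C KC] := row_freeP Kfree.
pose m := krylov_poly M 1%:M C.
have szm : size m = d.+1 by exact: size_krylov_poly.
have mM : horner_mx M m = 0.
  rewrite -[LHS]mulmx1; apply: krylov_poly_annihilates => X.
  by apply: det_mul_not_free; exact: Kmax.
have [u /eigenspaceP uM uN0] :
    exists2 u : 'rV_n.+1, (u <= eigenspace M l)%MS & u != 0.
  by apply/rowV0Pn; rewrite -mxrank_eq0 -lt0n (ltn_trans _ rk2).
have ml : m.[l] = 0.
  have := eigenvector_horner m uM; rewrite mM mulmx0 => /esym/eqP.
  by rewrite scalemx_eq0 (negbTE uN0) orbF => /eqP.
have /factor_theorem[h hm] : root m l by rewrite rootE ml.
have [hN0 szh] := factor_size szm hm.
(* [l] is a simple root of [m]: if [X - l] divided [h] too, symmetry of [M - l] would make [h]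
   itself annihilate [M], against the freeness of the first [d] powers. *)
have hl : h.[l] != 0.
  apply: contra_neq hN0 => hl0.
  have /factor_theorem[h2 hh2] : root h l by rewrite rootE hl0.
  apply: (krylov_free_annihilator Kfree); first by rewrite szh.
  rewrite mulmx1 hh2 mulrC rmorphM /=.
  apply: sym_ker_sq.
    by rewrite rmorphB /= horner_mx_X horner_mx_C linearB /= tr_scalar_mx AM.2.
  have := mM; rewrite hm hh2 -mulrA mulrC -mulrA !rmorphM /= => mM'.
  by rewrite mulmxE.
have prod0 i j : A i j ->
    forall w : 'rV_n.+1, w *m M = l *: w -> w 0 i * w 0 j = 0.
  move=> Aij.
  have [rho Hrho] : exists rho, forall e : 'rV_n.+1, e *m M = l *: e ->
      e *m sym_delta_mx R i j *m horner_mx M h *m 1%:M = rho *: (e *m 1%:M).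
    apply: (first_order (C := C)) => [t|]; last by rewrite -/m ml add0r.
    by apply: Kmax; apply: sym_realizationD AM _; exact: sym_realization_delta.
  have Hw (e w : 'rV_n.+1) : e *m M = l *: e -> w *m M = l *: w ->
      h.[l] * (e 0 i * w 0 j + e 0 j * w 0 i) = rho * (e *m w^T) 0 0.
    move=> eM wM.
    have := congr1 (fun X : 'rV_n.+1 => (X *m w^T) 0 0) (Hrho _ eM).
    rewrite /= !mulmx1 -scalemxAl [RHS]mxE -mulmxA => <-.
    have -> : horner_mx M h *m w^T = h.[l] *: w^T.

      rewrite -(trmx_horner h AM.2) -trmx_mul (eigenvector_horner h wM).
      by rewrite linearZ.
    by rewrite -scalemxAr mxE mul_sym_delta_mx !mxE.
  (* The hyperplane of vectors with zero coordinate [i] meets an eigenspace of dimension at least 2;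
     taking [e = w = v] then kills [rho]. *)
  have [v vM [vN0 vi]] :
      exists2 v : 'rV_n.+1, v *m M = l *: v & v != 0 /\ v 0 i = 0.
    have : (eigenspace M l :&: kermx (delta_mx i (0 : 'I_1)))%MS != 0.
      rewrite -mxrank_eq0 -lt0n -(ltn_add2l 1) addn0; apply: leq_trans rk2 _.
      rewrite -(mxrank_mul_ker (eigenspace M l) (delta_mx i (0 : 'I_1))).
      by rewrite leq_add2r rank_leq_col.
    case/rowV0Pn => v; rewrite sub_capmx => /andP[/eigenspaceP vM].
    move=> /sub_kermxP vi vN0.
    exists v => //; split=> //; move/matrixP/(_ 0 0): vi.
    by rewrite -colE !mxE.
  have rho0 : rho = 0.
    have /esym/eqP := Hw v v vM vM; rewrite vi mul0r mulr0 addr0 mulr0 mulf_eq0.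
    by case/orP => /eqP // /dotmx_eq0 v0; rewrite v0 eqxx in vN0.
  move=> w wM; have /eqP := Hw w w wM wM.
  rewrite rho0 mul0r mulf_eq0 (negbTE hl) /= [X in _ + X]mulrC -mulr2n.
  by rewrite mulrn_eq0 /= => /eqP.
have : (u *m M *m u^T) 0 0 = 0.
  rewrite mxE big1 // => j _; rewrite mxE mulr_suml big1 // => i _; rewrite mxE.
  case Aij: (A i j); last by rewrite AM.1 // mulr0 mul0r.
  by rewrite mulrAC prod0 // mul0r.
rewrite uM -scalemxAl mxE => /eqP; rewrite mulf_eq0 (negbTE lN0) /= => /eqP.
by move/dotmx_eq0 => u0; rewrite u0 eqxx in uN0.
Qed.

(** Take [g = h(M) delta_s], where [m = m(l) + h (X - l)] annihilates [delta_s]; then [c = - m(l)].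
    As [e_s = 0], the right-hand side of the first-order relation vanishes, leaving [e M' g = 0] for
    every symmetric elementary direction [M']. *)
Lemma maximal_resolvent (R : realType) n (A : structured n.+1 n.+1) d
    (M : 'M[R]_n.+1) l (e : 'rV_n.+1) s :
  symmetrically_structured A -> sym_realization A M ->
  krylov_maximal A d M (delta_mx s s) -> (\rank (eigenspace M l) <= 1)%N ->
  e *m M = l *: e -> e != 0 -> e 0 s = 0 ->
  exists g : 'cV_n.+1, exists2 c, c != 0 &
    M *m g = l *: g + c *: delta_mx s 0 /\
    forall i j, A i j -> e 0 i * g j 0 + e 0 j * g i 0 = 0.
Proof.
move=> Asym AM [Kfree Kmax] rk1 eM eN0 es.
have [C KC] := row_freeP Kfree.
pose m := krylov_poly M (delta_mx s s) C.
have szm : size m = d.+1 by exact: size_krylov_poly.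
have mM : horner_mx M m *m delta_mx s s = 0.
  apply: krylov_poly_annihilates => X; apply: det_mul_not_free; exact: Kmax.
have /factor_theorem[h /eqP] : root (m - m.[l]%:P) l.
  by rewrite rootE !hornerE subrr.
rewrite subr_eq addrC => /eqP hm.
pose g : 'cV_n.+1 := horner_mx M h *m delta_mx s 0.
have gW : horner_mx M h *m delta_mx s s = g *m delta_mx 0 s.
  by rewrite -mulmxA mul_delta_mx.
have Mg : M *m g = l *: g + (- m.[l]) *: delta_mx s 0.
  have := congr1 (mulmx^~ (delta_mx s (0 : 'I_1))) mM.
  rewrite mul0mx -mulmxA mul_delta_mx {1}hm rmorphD mulrC rmorphM rmorphB /=.
  rewrite horner_mx_X !horner_mx_C mulmxDl mul_scalar_mx -mulmxE -mulmxA -/g.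
  rewrite mulmxBl mul_scalar_mx addrC => /eqP; rewrite addr_eq0 subr_eq.
  by rewrite addrC scaleNr => /eqP.
exists g, (- m.[l]); last split=> //.
  (* If [m(l) = 0], then [g] lies in the eigenline of [e], yet [e g = h(l) e_s = 0]. So [g = 0], and
     [h] is an annihilator of too small a degree. *)
  rewrite oppr_eq0; apply/eqP => ml.
  rewrite ml oppr0 scale0r addr0 in Mg; rewrite ml add0r in hm.
  have [hN0 szh] := factor_size szm hm.
  have : (g^T <= e)%MS.
    have gE : (g^T <= eigenspace M l)%MS.
      by apply/eigenspaceP; rewrite -[in LHS]AM.2 -trmx_mul Mg linearZ.
    apply: submx_trans gE _.
    have /mxrank_leqif_sup[_ <-] : (e <= eigenspace M l)%MS.
      exact/eigenspaceP.
    rewrite eqn_leq rank_rV eN0 rk1 andbT lt0n mxrank_eq0.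
    by apply: contraNneq eN0 => E0; rewrite -submx0 -E0; apply/eigenspaceP.
  case/sub_rVP => a ga.
  have : (e *m g) 0 0 = 0.
    by rewrite mulmxA (eigenvector_horner h eM) -scalemxAl -colE !mxE es mulr0.
  rewrite -[g]trmxK ga linearZ /= -scalemxAr mxE => /eqP; rewrite mulf_eq0.
  case/orP => /eqP => [a0|/dotmx_eq0 e0]; last by rewrite e0 eqxx in eN0.
  have g0 : g = 0 by apply: trmx_inj; rewrite ga a0 scale0r trmx0.
  move/eqP: hN0; apply.
  apply: (krylov_free_annihilator Kfree); first by rewrite szh.
  by rewrite gW g0 mul0mx.
move=> i j Aij; rewrite -mul_sym_delta_mx.
have [|rho Hrho] := @first_order _ _ _ M _ (sym_delta_mx R i j) C l h _ hm.
  move=> t; apply: Kmax; apply: sym_realizationD AM _.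
  exact: sym_realization_delta.
have := Hrho _ eM; rewrite -mulmxA gW -(mul_delta_mx (0 : 'I_1) s s) !mulmxA.
rewrite -[e *m delta_mx s 0]colE => /matrixP/(_ 0 s).
have -> : col s e = 0 by apply/matrixP=> x y; rewrite !ord1 !mxE.
by rewrite mul0mx scaler0 [RHS]mxE mxE big_ord1 [X in _ * X]mxE !eqxx mulr1.
Qed.

Lemma maximal_support (R : realType) n (A : structured n.+1 n.+1)
    (d : 'I_n.+1 -> nat) (M : 'M[R]_n.+1) l (e : 'rV_n.+1) :
  symmetrically_structured A -> sym_realization A M ->
  (forall s, krylov_maximal A (d s) M (delta_mx s s)) ->
  (\rank (eigenspace M l) <= 1)%N -> l != 0 -> e *m M = l *: e ->
  forall s t, A s t -> e 0 s = 0 -> e 0 t = 0.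
Proof.
move=> Asym AM Kmax rk1 lN0 eM s0 t0 As0t0 es0.
have [->|eN0] := eqVneq e 0; first by rewrite mxE.
apply/eqP/negPn/negP => et0.
(* Each g = h_s(M) delta_s is a scaled column of the resolvent at l; it
   vanishes on the support of e and at s0, and symmetry of the resolvent then
   kills the column at s0. *)
have resolvent s : e 0 s = 0 -> exists g : 'cV_n.+1, exists2 c, c != 0 &
    M *m g = l *: g + c *: delta_mx s 0 /\
    [/\ forall t, e 0 t != 0 -> g t 0 = 0 & g s0 0 = 0].
  move=> es.
  have [g [c cN0 [Mg eg]]] := maximal_resolvent Asym AM (Kmax s) rk1 eM eN0 es.
  have g0 t : e 0 t != 0 -> g t 0 = 0.
    move=> et.
    have /matrixP/(_ t 0) := Mg; rewrite !mxE.
    have -> : (t == s) = false by apply: contraNF et => /eqP ->; rewrite es.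
    rewrite mulr0 addr0 => /(congr1 ( *%R (e 0 t))).
    rewrite mulr_sumr.
    (* The relations [e_j g_t + e_t g_j = 0] turn [e_t (M g)_t] into [- (e M)_t g_t = - l e_t g_t],
       whereas [M g = l g] at [t] makes it [l e_t g_t]. *)
    rewrite (eq_bigr (fun j => - (e 0 j * M j t * g t 0))); last first.
      move=> j _; have -> : M t j = M j t by rewrite -[in LHS]AM.2 mxE.
      case Ajt: (A j t); last by rewrite AM.1 // !(mul0r, mulr0) oppr0.
      have := eg _ _ Ajt => /eqP; rewrite addr_eq0 => /eqP egjt.
      by rewrite mulrCA -[e 0 t * _]opprK -egjt; ring.
    have /matrixP/(_ 0 t) := eM; rewrite !mxE => eMt.
    rewrite sumrN -mulr_suml eMt => /eqP.
    rewrite eq_sym -subr_eq0 opprK mulrCA mulrA -mulr2n mulrn_eq0 /=.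
    by rewrite !mulf_eq0 (negbTE lN0) (negbTE et) => /eqP.
  exists g, c => //; split=> //; split=> //.
  (* The edge from [s0] to [t0] gives [e_t0 g_s0 = 0]. *)
  have := eg _ _ As0t0; rewrite es0 mul0r add0r => /eqP.
  by rewrite mulf_eq0 (negbTE et0) => /eqP.
have [g0 [c0 c0N0 [Mg0 [g0e _]]]] := resolvent s0 es0.
move/eqP: c0N0; apply.
suff g00 : g0 = 0.
  have /matrixP/(_ s0 0) := Mg0.
  by rewrite g00 mulmx0 scaler0 add0r !mxE !eqxx mulr1 => <-.
apply/colP => s; rewrite mxE.
have [es|es] := eqVneq (e 0 s) 0; last exact: g0e.
have [g [c cN0 [Mg [ge gs0]]]] := resolvent s es.
have dotr (k : 'cV[R]_n.+1) (x : 'I_n.+1) : (k^T *m delta_mx x 0) 0 0 = k x 0.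
  rewrite mxE (bigD1 x) //= big1 ?addr0 => [|j jx]; rewrite !mxE.
    by rewrite !eqxx mulr1.
  by rewrite (negbTE jx) mulr0.
have tr1 (X : 'M[R]_1) : X 0 0 = X^T 0 0 by rewrite mxE.
(* Evaluating both sides gives [c0 g_s0 = c (g0)_s]; since [g_s0 = 0] and [c] is nonzero, [g0]
   vanishes at [s]. *)
have : (g^T *m (M *m g0)) 0 0 = (g0^T *m (M *m g)) 0 0.
  by rewrite [LHS]tr1 !trmx_mul trmxK AM.2 mulmxA.
rewrite Mg0 Mg !mulmxDr -!scalemxAr.
have addE (X Y : 'M[R]_1) : (X + Y) 0 0 = X 0 0 + Y 0 0 by rewrite mxE.
have sclE a (X : 'M[R]_1) : (a *: X) 0 0 = a * X 0 0 by rewrite mxE.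
rewrite !addE !sclE !dotr gs0 mulr0 addr0 tr1 trmx_mul trmxK => /eqP.
by rewrite eq_sym addrC -subr_eq0 addrK mulf_eq0 (negbTE cN0) => /eqP.
Qed.

(** * Generic properties *)

(** One polynomial is enough because finitely many conditions multiply; the point where it does not
    vanish makes the excluded variety visibly proper. *)
Definition generically (R : realType) N (Q : ('I_N -> R) -> Prop) : Prop :=
  exists p : {mpoly R[N]},
    (exists x, p.@[x] != 0) /\ forall x, p.@[x] != 0 -> Q x.

Lemma meval_line (R : realType) N (p : {mpoly R[N]}) (x y : 'I_N -> R) t :
  (mmap (@polyC R) (fun i => (x i)%:P + 'X * (y i - x i)%:P) p).[t] =
  p.@[fun i => x i + t * (y i - x i)].
Proof.
rewrite mevalE /mmap horner_sum; apply: eq_bigr => m _.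
rewrite hornerM hornerC /mmap1 horner_prod; congr (_ * _).
by apply: eq_bigr => i _; rewrite horner_exp !hornerE.
Qed.

Lemma generically_and (R : realType) N (Q1 Q2 : ('I_N -> R) -> Prop) :
  generically Q1 -> generically Q2 -> generically (fun x => Q1 x /\ Q2 x).
Proof.
move=> [p1 [[x1 px1] H1]] [p2 [[x2 px2] H2]]; exists (p1 * p2).
split; last first.
  by move=> x; rewrite mevalM mulf_eq0 negb_or => /andP[/H1 ? /H2].
(* Restrict to the line through the two witnesses. *)
pose line p := mmap (@polyC R) (fun i => (x1 i)%:P + 'X * (x2 i - x1 i)%:P) p.
have line_neq0 (p : {mpoly R[N]}) t : (line p).[t] != 0 -> line p != 0.
  by apply: contra_neq => ->; rewrite horner0.
have /poly_neq0_eval[t] : line p1 * line p2 != 0.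
  rewrite mulf_neq0 //.
    apply: (line_neq0 _ 0); rewrite meval_line (meval_eq (v2 := x1)) // => i.
    by rewrite mul0r addr0.
  apply: (line_neq0 _ 1); rewrite meval_line (meval_eq (v2 := x2)) // => i.
  by rewrite mul1r addrC subrK.
rewrite hornerM !meval_line -mevalM => px.
by exists (fun i => x1 i + t * (x2 i - x1 i)).
Qed.

Lemma generically_mono (R : realType) N (Q1 Q2 : ('I_N -> R) -> Prop) :
  (forall x, Q1 x -> Q2 x) -> generically Q1 -> generically Q2.
Proof. by move=> Q12 [p [px H]]; exists p; split=> // x /H /Q12. Qed.

Lemma generically_forall (R : realType) N (I : finType)
    (Q : I -> ('I_N -> R) -> Prop) :
  (forall i, generically (Q i)) -> generically (fun x => forall i, Q i x).
Proof.
move=> Qi.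
suff [p [px H]] : generically (fun x => forall i, i \in enum I -> Q i x).
  by exists p; split=> // x /H Hx i; apply: Hx; rewrite mem_enum.
elim: (enum I) => [|i s IHs].
  by exists 1; split=> //; exists (fun=> 0); rewrite meval1 oner_neq0.
apply: generically_mono (generically_and (Qi i) IHs) => x [Qx Hx] j.
by rewrite inE => /orP[/eqP -> //|/Hx].
Qed.

Lemma rank_minor (F : fieldType) d q r (K : 'M[F]_(d, q)) :
  (r <= \rank K)%N -> exists U V, U *m K *m V = 1%:M :> 'M_r.
Proof.
move=> rK; exists (pid_mx r *m invmx (col_ebase K)).
exists (invmx (row_ebase K) *m pid_mx r).
rewrite -[X in _ *m X *m _]mulmx_ebase !mulmxA mulmxKV ?col_ebase_unit //.
rewrite mulmxK ?row_ebase_unit // !mul_pid_mx.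
have rd : (r <= d)%N := leq_trans rK (rank_leq_row K).
have rq : (r <= q)%N := leq_trans rK (rank_leq_col K).
by rewrite (_ : minn _ _ = r) ?pid_mx_1 //; lia.
Qed.

(** Constant [U] and [V] with [U K V = 1] at [x0] certify the rank there; [det (U K V)] is then a
    polynomial whose nonvanishing bounds the rank from below everywhere else. *)
Lemma generic_rank (R : realType) N d q r (K : 'M[{mpoly R[N]}]_(d, q)) x0 :
  (r <= \rank (map_mx (meval x0) K))%N ->
  generically (fun x => (r <= \rank (map_mx (meval x) K))%N).
Proof.
case/rank_minor=> U [V UKV].
pose up a b := @map_mx _ {mpoly R[N]} (@mpolyC N R) a b.
have upK a b x (X : 'M[R]_(a, b)) : map_mx (meval x) (up _ _ X) = X.
  by apply/matrixP=> i j; rewrite !mxE mevalC.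
exists (\det (up _ _ U *m K *m up _ _ V)); split=> [|x].
  by exists x0; rewrite -det_map_mx !map_mxM !upK UKV det1 oner_neq0.
rewrite -det_map_mx !map_mxM !upK -unitfE -unitmxE -row_free_unit => /eqP <-.
by apply: leq_trans (mxrankM_maxl _ _) _; exact: mxrankM_maxr.
Qed.

Lemma generic_krylov_maximal (R : realType) N n (A : structured n.+1 n.+1)
    (G : 'M[{mpoly R[N]}]_n.+1) (W : 'M[R]_n.+1) :
  (forall M, sym_realization A M -> exists x, M = map_mx (meval x) G) ->
  exists d, generically (fun x => krylov_maximal A d (map_mx (meval x) G) W).
Proof.
move=> Gsurj.
pose P d := exists x, row_free (krylov d (map_mx (meval x) G) W).
have P0 : P 0%N.
  by exists (fun=> 0); rewrite -row_leq_rank leq0n.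
(* [P] holds at 0 and fails beyond the number of matrix entries, so it breaks between some [d] and
   [d.+1]. *)
have [d [[x0 Px0] Pd1]] : exists d, P d /\ ~ P d.+1.
  apply: contrapT => noMax.
  have Pall d : P d.
    elim: d => // d IHd; apply: contrapT => Pd1; apply: noMax.
    by exists d.
  have [x] := Pall (n.+1 * n.+1).+1.
  by rewrite -row_leq_rank => /leq_trans/(_ (rank_leq_col _)); rewrite ltnn.
have kE d' x : map_mx (meval x) (krylov d' G (map_mx (@mpolyC N R) W)) =
              krylov d' (map_mx (meval x) G) W.
  rewrite krylov_map; congr krylov.
  by apply/matrixP=> i j; rewrite !mxE /= mevalC.
exists d.
have : (d <= \rank (map_mx (meval x0) (krylov d G (map_mx (@mpolyC N R) W))))%N.
  by rewrite kE row_leq_rank.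
move/generic_rank; apply: generically_mono => x.
rewrite kE row_leq_rank => Kfree; split=> // M /Gsurj[y ->].
apply/negP => Ky; apply: Pd1.
by exists y.
Qed.

(** * Generic rank and term rank *)

Lemma injections_perm n k (r c : 'I_k -> 'I_n) :
  injective r -> injective c -> exists s : 'S_n, forall l, s (r l) = c l.
Proof.
move=> rI cI.
suff step j : (j <= k)%N ->
    exists s : 'S_n, forall l : 'I_k, (l < j)%N -> s (r l) = c l.
  by have [//|s Hs] := step k; exists s => l; apply: Hs.
elim: j => [|j IHj] jk; first by exists 1%g.
have [s Hs] := IHj (ltnW jk); pose l0 := Ordinal jk.
(* Swapping [s (r l0)] with [c l0] afterwards corrects the image of [r l0] and leaves the earlier
   images alone, since injectivity keeps them away from both points. *)
exists (s * tperm (s (r l0)) (c l0))%g => l; rewrite ltnS leq_eqVlt permM.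
have [ll0 _|ll0 /= lj] := eqVneq l l0; first by rewrite ll0 tpermL.
have {}lj : (l < j)%N.
  by case/orP: lj => // /eqP lj; case/eqP: ll0; apply: val_inj.
rewrite [s (r l)]Hs // tpermD //; last by rewrite (inj_eq cI) eq_sym.
by rewrite -Hs // (inj_eq perm_inj) (inj_eq rI) eq_sym.
Qed.

(** The choice depends on the orbit as a set only, hence is constant along each cycle; the default
    is never reached. *)
Definition orbit_rep n (s : 'S_n) (x : 'I_n) : 'I_n :=
  odflt x [pick y in porbit s x].

Lemma orbit_rep_in n (s : 'S_n) x : orbit_rep s x \in porbit s x.
Proof. by rewrite /orbit_rep; case: pickP => //= /(_ x); rewrite porbit_id. Qed.

Lemma orbit_rep_perm n (s : 'S_n) x : orbit_rep s (s x) = orbit_rep s x.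
Proof.
rewrite /orbit_rep; have -> : porbit s (s x) = porbit s x.
  exact: (porbit_perm s 1).
by case: pickP => //= /(_ x); rewrite porbit_id.
Qed.

Lemma sum_double (F : nat -> nat) h :
  (\sum_(j < h.*2) F j = \sum_(i < h) F i.*2 + \sum_(i < h) F i.*2.+1)%N.
Proof.
elim: h => [|h IHh]; first by rewrite !big_ord0.
by rewrite doubleS !big_ord_recr /= IHh -addnA addnACA.
Qed.

(* A kernel vector of the weighted permutation-like symmetric matrix with weight
   [d x] on the edge from x to its image satisfies [uE].  Doubling the weight at
   exactly one point of each cycle makes the two alternating products around an
   even cycle differ; odd cycles are excluded by a sign. *)
Lemma perm_two_step (R : realFieldType) n (s : 'S_n) (d u : 'I_n -> R) :
  (forall x, d x != 0 -> d x = if x == orbit_rep s x then 2 else 1) ->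
  (forall x, d (s x) = 0 -> u x = 0) ->
  (forall x, d (s x) * u x = - (d (s (s x)) * u (s (s x)))) ->
  forall x, u x = 0.
Proof.
move=> dE du uE x; apply/eqP/negPn/negP => ux.
pose y i := iter i s x.
have y2 i : [/\ u (y i.*2) != 0, d (y i.*2.+1) != 0 & d (y i.*2.+2) != 0].
  have step z : u z != 0 ->
      [/\ d (s z) != 0, d (s (s z)) != 0 & u (s (s z)) != 0].
    move=> uz; have dz : d (s z) != 0 by apply: contra_neq uz => /du.
    have : d (s z) * u z != 0 by rewrite mulf_neq0.
    by rewrite uE oppr_eq0 mulf_eq0 negb_or => /andP[].
  elim: i => [|i [ui di di2]]; first by case: (step _ ux).
  have [_ _ u2] := step _ ui; have [d3 d4 _] := step _ u2.
  by rewrite doubleS.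
pose L := #|porbit s x|.
have yL : y L = y 0%N by exact: iter_porbit.
have yr i : orbit_rep s (y i) = orbit_rep s x.
  by elim: i => //= i <-; exact: orbit_rep_perm.
case: (boolP (odd L)) => [Lodd|/negbTE Leven].
  (* On an odd cycle [Y] changes sign at each step but returns to its value after [L] steps, so it
     is 0. Nonvanishing reaches every point there, because an odd cycle is exhausted by steps of
     two. *)
  pose Y i := d (y i.+1) * u (y i) * u (y i.+1).
  have YS i : Y i.+1 = - Y i.
    have := uE (y i); rewrite /Y -[s (y i)]/(y i.+1) -[s (y i.+1)]/(y i.+2).
    by move=> ->; ring.
  have YE i : Y i = (-1) ^+ i * Y 0%N.
    by elim: i => [|i IHi]; rewrite ?mul1r // YS IHi exprS; ring.
  have yL1 : y L.+1 = y 1%N by rewrite /y /= -/(y L) yL.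
  have : Y L = Y 0%N by rewrite /Y yL1 yL.
  rewrite YE -signr_odd Lodd mulN1r => /eqP; rewrite eq_sym -addr_eq0 -mulr2n.
  rewrite mulrn_eq0 /= /Y -yL1 !mulf_eq0 (negbTE ux) /= orbF.
  have u1 : u (y L.+1) != 0.
    by have [+ _ _] := y2 (L.+1)./2; rewrite even_halfK //= Lodd.
  rewrite (negbTE u1) orbF yL; apply/negP.
  by have [_ + _] := y2 0%N.
pose h := L./2; have Lh : L = h.*2 by rewrite even_halfK // Leven.
pose F i : nat := (y i == orbit_rep s x).
have dF i : d (y i) != 0 -> d (y i) = 2 ^+ F i.
  by move=> /dE ->; rewrite yr /F; case: eqP; rewrite ?expr0 ?expr1.
(* Telescoping [uE] in absolute value compares the weights at odd and even positions; the exponents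
   count the doubled weights. *)
have norm_u j : `|u x| * 2 ^+ (\sum_(i < j) F i.*2.+1) =
                `|u (y j.*2)| * 2 ^+ (\sum_(i < j) F i.*2.+2).
  elim: j => [|j IHj]; first by rewrite !big_ord0.
  rewrite !big_ord_recr /= !exprD mulrA IHj mulrAC [RHS]mulrA.
  rewrite [RHS]mulrAC; congr (_ * _).
  have [_ d1 d2] := y2 j.
  rewrite -!dF //.
  have dge z : d z != 0 -> 0 <= d z by move/dE->; case: ifP.
  rewrite -[d (y _.+1)]ger0_norm ?dge // -[d (y _.+2)]ger0_norm ?dge //.
  by rewrite -!normrM mulrC [X in _ = `|X|]mulrC /y /= uE normrN.
have sums_eq : (\sum_(i < h) F i.*2.+1 = \sum_(i < h) F i.*2.+2)%N.
  have := norm_u h; rewrite -Lh yL => /mulfI; rewrite normr_eq0 => /(_ ux).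
  by rewrite -!natrX => /eqP; rewrite eqr_nat eqn_exp2l // => /eqP.
have sum_shift : (\sum_(i < h) F i.*2.+2 = \sum_(i < h) F i.*2)%N.
  have Fh : F h.*2 = F 0%N by rewrite -Lh /F yL.
  case: (h) Fh => [|h'] Fh; first by rewrite !big_ord0.
  by rewrite big_ord_recr [RHS]big_ord_recl /= -doubleS Fh addnC.
(* Exactly one weight of the cycle is doubled, while equal counts at odd and even positions would
   make the total even. *)
have : (\sum_(j < L) F j = 1)%N.
  transitivity (count_mem (orbit_rep s x) (traject s x L)).
    rewrite -sum1_count (big_nth x) size_traject big_mkord [RHS]big_mkcond.
    by apply: eq_bigr => i _; rewrite nth_traject // /F /y; case: eqP.
  rewrite count_uniq_mem ?uniq_traject_porbit // -porbit_traject.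
  by rewrite orbit_rep_in.
rewrite Lh sum_double sums_eq sum_shift addnn => /(congr1 odd).
by rewrite odd_double.
Qed.

(** The transversal is extended to a permutation [s], and its edges are weighted and symmetrized.
    Only the rows indexed by [c] are shown independent: a relation between them is a vector [u]
    supported on the image of [c], to which [perm_two_step] applies with [t], the inverse of [s]. *)
Lemma transversal_realization (R : realType) n k (A : structured n n) :
  symmetrically_structured A -> has_transversal A k ->
  exists2 M : 'M[R]_n, sym_realization A M & (k <= \rank M)%N.
Proof.
move=> Asym /existsP[r /existsP[c]].
move=> /and3P[/injectiveP rI /injectiveP cI /forallP Arc].
have [s Hs] := injections_perm rI cI.
pose t := (s^-1)%g.
have st x : s (t x) = x by rewrite permKV.
have ts x : t (s x) = x by rewrite permK.
pose d x : R :=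
  if x \in codom r then if x == orbit_rep t x then 2 else 1 else 0.
pose M : 'M[R]_n := \matrix_(i, j) (d i *+ (s i == j) + d j *+ (s j == i)).
have dA i : d i != 0 -> A i (s i).
  rewrite /d; case: ifP; rewrite ?eqxx // => /codomP[l ->] _.
  by rewrite Hs.
exists M.
  split=> [i j Aij|]; last by apply/matrixP=> i j; rewrite !mxE addrC.
  rewrite mxE; case: (s i =P j) => [sij|_]; case: (s j =P i) => [sji|_];
    rewrite ?mulr1n ?mulr0n ?addr0 ?add0r //.
  - have [-> | /dA] := eqVneq (d i) 0; last by rewrite sij Aij.
    have [-> | /dA] := eqVneq (d j) 0; last by rewrite sji Asym Aij.
    by rewrite addr0.
  - by have [-> // | /dA] := eqVneq (d i) 0; rewrite sij Aij.
  - by have [-> // | /dA] := eqVneq (d j) 0; rewrite sji Asym Aij.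
pose E : 'M[R]_(k, n) := \matrix_(l, j) (c l == j)%:R.
apply: leq_trans (mxrankM_maxr E M).
rewrite row_leq_rank; apply: inj_row_free => v vEM.
pose u x := (v *m E) 0 x.
have uc l : u (c l) = v 0 l.
  rewrite /u mxE (bigD1 l) //= big1 => [|l' l'l]; rewrite !mxE.
    by rewrite eqxx mulr1 addr0.
  by rewrite (inj_eq cI) (negbTE l'l) mulr0.
suff u0 x : u x = 0 by apply/rowP => l; rewrite mxE -uc.
apply: (@perm_two_step _ _ t d u).
- by move=> y; rewrite /d; case: ifP => //; rewrite eqxx.
- move=> y dy; rewrite /u mxE big1 // => l _; rewrite !mxE.
  case: eqP => [cl|_]; rewrite ?mulr0 //.
  move: dy; rewrite -cl -Hs ts /d codom_f; case: ifP => _ /eqP.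
    by rewrite pnatr_eq0.
  by rewrite oner_eq0.
move=> y; apply/eqP; rewrite -addr_eq0.
(* The two-step recurrence at [y] is the coordinate [t y] of [u M = 0], whose only contributions
   come from [y] and [t (t y)]. *)
have := congr1 (fun X : 'rV_n => X 0 (t y)) vEM.
rewrite mulmxA [RHS]mxE => /eqP; apply: contraLR => H.
apply: contra_neq H => <-; rewrite mxE.
transitivity (\sum_j (u j * (d j *+ (j == t (t y))) +
                      u j * (d (t y) *+ (j == y)))).
  rewrite big_split /= (bigD1 (t (t y))) //= eqxx.
  rewrite big1 => [|j /negbTE ->]; last by rewrite mulr0.
  rewrite (bigD1 y) //= eqxx big1 => [|j /negbTE ->]; last by rewrite mulr0.
  by rewrite !addr0 /= !mulr1n; ring.
apply: eq_bigr => j _; rewrite [M j _]mxE mulrDr st.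
congr (_ * (_ *+ _) + _ * (_ *+ _)).
  by rewrite -(inj_eq (@perm_inj _ s) j) st.
by rewrite eq_sym.
Qed.

(** A nonzero minor of order [\rank M] has a nonzero term in its Leibniz expansion, and the
    positions of that term form a transversal. *)
Lemma rank_le_term_rank (R : realType) n (A : structured n n) (M : 'M[R]_n) :
  realization A M -> (\rank M <= term_rank A)%N.
Proof.
move=> AM; rewrite /term_rank; case: ex_maxnP => i _; apply.
pose f := maxrankfun M; pose M1 := rowsub f M.
have M1full : row_full M1^T.
  by rewrite /row_full mxrank_tr; exact: maxrowsub_free.
pose g := fullrankfun M1full.
have := fullrowsub_unit M1full; rewrite unitmxE unitfE => detN0.
have [s sN0] : exists s : 'S_(\rank M), \prod_i (rowsub g M1^T) i (s i) != 0.
  apply/existsP; apply: contraNT detN0; rewrite negb_exists => /forallP H.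
  rewrite /determinant big1 // => s _.
  by have := H s; rewrite negbK => /eqP ->; rewrite mulr0.
apply/existsP; exists [ffun l => f (s l)].
apply/existsP; exists [ffun l => g l].
apply/and3P; split.
- apply/injectiveP => x y; rewrite [LHS]ffunE [RHS]ffunE => /maxrankfun_inj.
  exact: perm_inj.
- by apply/injectiveP => x y; rewrite [LHS]ffunE [RHS]ffunE => /fullrankfun_inj.
apply/forallP => l; rewrite ffunE [X in A _ X]ffunE; apply: contraNT sN0 => Afg.
by rewrite (bigD1 l) //= !mxE AM ?mul0r //; apply/negbTE.
Qed.

(** * Modes *)

Lemma rank_diag_mx (F : fieldType) n (d : 'rV[F]_n) :
  \rank (diag_mx d) = #|[set i | d 0 i != 0]|.
Proof.
set S := [set i | _]; pose f : 'I_#|S| -> 'I_n := @enum_val _ (mem S).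
pose P : 'M[F]_(#|S|, n) := \matrix_(a, i) (f a == i)%:R.
have fI : injective f by exact: enum_val_inj.
have Pd a j : (P *m diag_mx d) a j = (f a == j)%:R * d 0 j.
  by rewrite mul_mx_diag !mxE.
apply/eqP; rewrite eqn_leq; apply/andP; split.
  have -> : diag_mx d = P^T *m (P *m diag_mx d).
    apply/matrixP=> i j; rewrite [RHS]mxE.
    under eq_bigr => a _ do rewrite Pd !mxE mulrA.
    rewrite -mulr_suml mxE.
    have [iS|iS] := boolP (i \in S); last first.
      have di0 : d 0 i = 0 by apply/eqP; move: iS; rewrite inE negbK.
      rewrite di0 mul0rn big1 ?mul0r // => a _.
      case: eqP => [fai|_]; rewrite ?mul0r //.
      by case/negP: iS; rewrite -fai; exact: (enum_valP a).
    rewrite (bigD1 (enum_rank_in iS i)) //= big1 => [|a ai].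
      rewrite /f enum_rankK_in // eqxx mul1r addr0.
      by case: eqP => [->|]; rewrite ?mul1r ?mul0r.
    case: eqP => [fai|_]; rewrite ?mul0r //; case/eqP: ai; apply: fI.
    by rewrite /f enum_rankK_in.
  apply: leq_trans (mxrankM_maxr _ _) _; exact: rank_leq_row.
apply: leq_trans (mxrankM_maxr P _).
rewrite row_leq_rank; apply: inj_row_free => v vPd; apply/rowP => a.
have := congr1 (fun X : 'rV_n => X 0 (f a)) vPd; rewrite !mxE.
rewrite (bigD1 a) //= big1 => [|b ba]; last first.
  by rewrite Pd (inj_eq fI) (negbTE ba) mul0r mulr0.
rewrite Pd eqxx mul1r addr0 => /eqP; rewrite mulf_eq0 => /orP[/eqP //|da].
by have := enum_valP a; rewrite inE -/(f a) da.
Qed.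

(** Unitary diagonalization over [R[i]] has real eigenvalues, and [\rank (M - l)] counts those
    different from [l]. Geometric and algebraic multiplicities thus agree, and [\rank M] counts the
    nonzero eigenvalues. *)
Lemma symmetric_simple_modes (R : realType) n (M : 'M[R]_n) :
  M^T = M -> (forall l, l != 0 -> (\rank (eigenspace M l) <= 1)%N) ->
  exists ls : seq R, [/\ uniq ls, size ls = \rank M &
    forall l, l \in ls -> l != 0 /\ simple_eigenvalue M l%:C%C].
Proof.
move=> Msym Msimple; set Mc := complexify M.
have Mherm : Mc \is hermsymmx.
  apply: realsym_hermsym.
    apply/is_hermitianmxP/matrixP => i j; rewrite expr0 scale1r !mxE.
    by rewrite -[in LHS]Msym mxE.
  by apply/mxOverP => i j; rewrite mxE; apply/complex_realP; exists (M i j).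
have /orthomx_spectralP := hermitian_normalmx Mherm.
set P := spectralmx Mc; set D := spectral_diag Mc => McE.
have Pu : P \in unitmx by exact: spectral_unit.
have /fin_all_exists[d dE] i : exists x, D 0 i = x%:C%C.
  by apply/complex_realP; exact/mxOverP/hermitian_spectral_diag_real.
have chi : char_poly Mc = \prod_(i < n) ('X - (d i)%:C%C%:P).
  have -> : char_poly Mc = char_poly (diag_mx D).
    rewrite /char_poly /char_poly_mx.
    have -> : 'X%:M - map_mx polyC Mc = map_mx polyC (invmx P) *m
        ('X%:M - map_mx polyC (diag_mx D)) *m map_mx polyC P.
      rewrite mulmxBr mulmxBl -!map_mxM -McE mul_mx_scalar -scalemxAl -map_mxM.
      by rewrite mulVmx // map_mx1 scalemx1.
    rewrite !det_mulmx mulrAC -det_mulmx -map_mxM mulVmx //.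
    by rewrite map_mx1 det1 mul1r.
  rewrite char_poly_trig ?diag_mx_is_trig //.
  by apply: eq_bigr => i _; rewrite mxE eqxx mulr1n dE.
have rankE l : \rank (M - l%:M) = #|[set i | d i != l]|.
  rewrite -(mxrank_map (real_complex R)) map_mxB map_scalar_mx -/Mc.
  have -> : Mc - (l%:C%C)%:M = invmx P *m (diag_mx (D - const_mx l%:C%C)) *m P.
    by rewrite linearB /= diag_const_mx mulmxBr mulmxBl -McE mul_mx_scalar
      -scalemxAl mulVmx // scalemx1.
  rewrite mxrankMfree ?row_free_unit // -mxrank_tr trmx_mul.
  rewrite mxrankMfree; last first.
    by rewrite row_free_unit unitmx_tr unitmx_inv.
  rewrite mxrank_tr rank_diag_mx; apply: eq_card => i.
  by rewrite !inE !mxE dE subr_eq0 (inj_eq (@complexI _)).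
have mult l : l != 0 -> (count_mem l [seq d i | i : 'I_n] <= 1)%N.
  move=> /Msimple; rewrite mxrank_ker rankE.
  suff -> : (n - #|[set i | d i != l]|)%N =
            count_mem l [seq d i | i : 'I_n] by [].
  have := cardC [set i | d i != l]; rewrite card_ord => nE.
  rewrite -[X in (X - _)%N]nE addKn count_map enumT cardE /enum_mem size_filter.
  by apply: eq_count => i; rewrite !inE negbK.
have chiM : char_poly Mc = \prod_(x <- [seq (d i)%:C%C | i : 'I_n]) ('X - x%:P).
  by rewrite chi big_image.
exists [seq x <- [seq d i | i : 'I_n] | x != 0]; split.
- apply/count_mem_uniq => l; rewrite count_filter mem_filter.
  have [->|lN0] := eqVneq l 0.
    rewrite /= -[RHS]/0%N; apply/eqP; rewrite -leqn0 leqNgt -has_count.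
    by apply/hasPn => x _ /=; case: eqP => // ->; rewrite eqxx.
  rewrite /= (eq_count (a2 := pred1 l)) => [|x]; last first.
    by rewrite /=; case: eqP => // ->.
  by have := mult _ lN0; rewrite -has_pred1 has_count; case: count => [|[]].
- have := rankE 0; rewrite raddf0 subr0 => ->.
  rewrite size_filter count_map enumT cardE /enum_mem size_filter.
  by apply: eq_count => i; rewrite !inE.
move=> l; rewrite mem_filter => /andP[lN0 ld]; split=> //.
rewrite /simple_eigenvalue -/Mc chiM mu_prod_XsubC.
rewrite count_map (eq_count (a2 := preim d (pred1 l))); last first.
  by move=> i; rewrite /= (inj_eq (@complexI _)).
have := mult _ lN0; move: ld; rewrite -has_pred1 has_count count_map.
by case: count => [|[]].
Qed.

(** Meant for [f] the real or the imaginary part, so that a complex mode with real eigenvalue splits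
    into two real vectors. *)
Lemma map_mx_complexify (R : realType) (f : R[i] -> R) m n p
    (E : 'M[R[i]]_(m, n)) (X : 'M[R]_(n, p)) :
  f 0 = 0 -> {morph f : x y / x + y} ->
  (forall z x, f (z * x%:C%C) = f z * x) ->
  map_mx f (E *m complexify X) = map_mx f E *m X.
Proof.
move=> f0 fD fM; apply/matrixP=> i j; rewrite !mxE (big_morph f fD f0).
by apply: eq_bigr => l _; rewrite !mxE fM.
Qed.

(** A permutation that lists [T] first exhibits the block form with [q = #|T|]. *)
Lemma closed_set_reducible n m (A : structured n n) (B : structured n m)
    (T : {set 'I_n}) :
  T != set0 ->
  (forall i j, i \in T -> j \notin T -> A i j = false) ->
  (forall i j, i \in T -> B i j = false) -> reducible A B.
Proof.
move=> TN0 AT BT.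
have Tn : (#|T| <= n)%N by rewrite -[n in leqRHS]card_ord max_card.
have [s sE] : exists s : 'S_n,
    forall l : 'I_#|T|, s (widen_ord Tn l) = enum_val l.
  apply: injections_perm enum_val_inj => a b /(congr1 val) /= ab.
  exact: val_inj.
have sT i : (s i \in T) = (i < #|T|)%N.
  apply/idP/idP => [siT|iT].
    have := sE (enum_rank_in siT (s i)).
    by rewrite enum_rankK_in // => /perm_inj <-; rewrite /= ltn_ord.
  rewrite (_ : i = widen_ord Tn (Ordinal iT)); last exact: val_inj.
  by rewrite sE enum_valP.
exists s, #|T|; split=> [|i j iT Tj|i j iT].
- by rewrite Tn andbT lt0n cards_eq0.
- by rewrite !mxE AT // sT // -leqNgt.
by rewrite mxE BT // sT.
Qed.

(** * Generic matrices in the parameters and the augmented pattern *)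

Lemma sum_entries_at (R : nmodType) m n (S : {set 'I_m * 'I_n})
    (M : 'M[R]_(m, n)) p :
  \sum_(k < #|S| | enum_val k == p) entries_at S M 0 k =
  if p \in S then M p.1 p.2 else 0.
Proof.
case: ifP => pS; last first.
  by rewrite big1 // => k /eqP kp; rewrite -kp enum_valP in pS.
rewrite (bigD1 (enum_rank_in pS p)) /= ?enum_rankK_in //.
rewrite big1 => [|k /andP[/eqP kp]].
  by rewrite addr0 mxE enum_rankK_in.
by case/eqP; apply: enum_val_inj; rewrite kp enum_rankK_in.
Qed.

Section GenericPair.
Variables (R : realType) (n m : nat) (A : structured n n) (B : structured n m).
Local Notation N := (#|sym_free_pos A| + #|free_pos B|)%N.

(** The sum has one term, the variable of that position, or none at a fixed zero; entries below the
    diagonal look up their mirror image. *)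
Definition generic_state : 'M[{mpoly R[N]}]_n :=
  \matrix_(i, j) \sum_(k < #|sym_free_pos A| |
      enum_val k == if (i <= j)%N then (i, j) else (j, i)) 'X_(lshift _ k).

Definition generic_input : 'M[{mpoly R[N]}]_(n, m) :=
  \matrix_(i, j) \sum_(k < #|free_pos B| |
      enum_val k == (i, j)) 'X_(rshift _ k).

Definition parameters (At : 'M[R]_n) (Bt : 'M[R]_(n, m)) : 'I_N -> R :=
  row_mx (entries_at (sym_free_pos A) At) (entries_at (free_pos B) Bt) 0.

Lemma generic_stateE At Bt : symmetrically_structured A ->
  sym_realization A At ->
  map_mx (meval (parameters At Bt)) generic_state = At.
Proof.
move=> Asym [zAt sAt]; apply/matrixP=> i j; rewrite !mxE raddf_sum /=.
under eq_bigr => k _ do rewrite mevalXU /parameters row_mxEl.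
rewrite sum_entries_at inE; case: ifP => [/andP[_ _]|].
  by case: ifP => // _; rewrite -[in RHS]sAt mxE.
move=> Aij; rewrite zAt //; move: Aij.
case: leqP => /= [|/ltnW] ->; rewrite andbT //.
by rewrite Asym.
Qed.

Lemma generic_inputE At Bt : realization B Bt ->
  map_mx (meval (parameters At Bt)) generic_input = Bt.
Proof.
move=> zBt; apply/matrixP=> i j; rewrite !mxE raddf_sum /=.
under eq_bigr => k _ do rewrite mevalXU /parameters row_mxEr.
by rewrite sum_entries_at inE; case: ifP => // /zBt.
Qed.

(** Inputs become extra vertices of a symmetric pattern having exactly the free parameters of the
    pair, so that the same exceptional polynomial can serve both. *)
Definition augmented : structured (n + m) (n + m) :=
  block_mx A B B^T (const_mx false).

Lemma augmented_sym : symmetrically_structured A ->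
  symmetrically_structured augmented.
Proof.
move=> Asym i j; have /matrixP/(_ j i) : augmented^T = augmented.
  rewrite /augmented tr_block_mx trmxK trmx_const; congr block_mx.
  by apply/matrixP=> x y; rewrite mxE.
by rewrite mxE => <-.
Qed.

Lemma augmented_realization (At : 'M[R]_n) (Bt : 'M[R]_(n, m)) :
  sym_realization A At -> realization B Bt ->
  sym_realization augmented (block_mx At Bt Bt^T 0).
Proof.
move=> [zAt sAt] zBt; split; last by rewrite tr_block_mx trmxK sAt trmx0.
move=> i j; rewrite /augmented -(splitK i) -(splitK j).
case: (split i) => x; case: (split j) => y /=;
  rewrite ?(block_mxEul, block_mxEur, block_mxEdl, block_mxEdr) ?mxE //.
- exact: zAt.
- exact: zBt.
- exact: zBt.
Qed.

Lemma generic_augmentedE At Bt : symmetrically_structured A ->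
  sym_realization A At -> realization B Bt ->
  map_mx (meval (parameters At Bt))
    (block_mx generic_state generic_input generic_input^T 0) =
  block_mx At Bt Bt^T 0.
Proof.
move=> Asym AAt BBt; rewrite map_block_mx -map_trmx map_mx0.
by rewrite generic_stateE ?generic_inputE.
Qed.

Lemma augmented_realizationP (M : 'M[R]_(n + m)) :
  sym_realization augmented M ->
  exists At Bt, [/\ sym_realization A At, realization B Bt &
    M = block_mx At Bt Bt^T 0].
Proof.
move=> [zM sM]; exists (ulsubmx M), (ursubmx M).
have zul : realization A (ulsubmx M).
  by move=> i j Aij; rewrite !mxE zM // /augmented block_mxEul.
have zur : realization B (ursubmx M).
  by move=> i j Bij; rewrite !mxE zM // /augmented block_mxEur.
split=> //; first by split=> //; rewrite trmx_ulsub sM.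
rewrite -[LHS]submxK trmx_ursub sM; congr block_mx.
by apply/matrixP=> i j; rewrite !mxE zM // /augmented block_mxEdr mxE.
Qed.

End GenericPair.

(** * Supports of uncontrollable modes and the exceptional variety *)

Lemma term_rank_transversal m n (M : structured m n) :
  has_transversal M (term_rank M).
Proof. by rewrite /term_rank; case: ex_maxnP. Qed.

(** The extension [(e, 0)] is an eigenvector of the augmented matrix and vanishes at every input
    vertex; zeros then propagate along edges, from inputs to states and between states. *)
Lemma mode_support (R : realType) n m (A : structured n.+1 n.+1)
    (B : structured n.+1 m) (At : 'M[R]_n.+1) (Bt : 'M[R]_(n.+1, m))
    (d : 'I_(n.+1 + m) -> nat) d1 l (e : 'rV[R]_n.+1) :
  symmetrically_structured A -> sym_realization A At -> realization B Bt ->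
  (forall s, krylov_maximal (n := n + m) (augmented A B) (d s)
     (block_mx At Bt Bt^T 0) (delta_mx s s)) ->
  krylov_maximal (n := n + m) (augmented A B) d1 (block_mx At Bt Bt^T 0) 1%:M ->
  l != 0 -> e *m At = l *: e -> e *m Bt = 0 ->
  (forall i j, A i j -> e 0 i = 0 -> e 0 j = 0) /\
  (forall i j, B i j -> e 0 i = 0).
Proof.
move=> Asym AAt BBt Kd K1 lN0 eA eB.
have Hsym := augmented_sym B Asym.
have HM := augmented_realization AAt BBt.
pose e' : 'rV[R]_(n.+1 + m) := row_mx e 0.
have eM : e' *m block_mx At Bt Bt^T 0 = l *: e'.
  by rewrite mul_row_block eA eB !mul0mx !addr0 scale_row_mx scaler0.
have rk1 := @maximal_eigenspace R (n + m) _ _ _ l Hsym HM K1 lN0.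
have supp := @maximal_support R (n + m) _ d _ l e' Hsym HM Kd rk1 lN0 eM.
have el i : e' 0 (lshift m i) = e 0 i by rewrite row_mxEl.
have er j : e' 0 (rshift n.+1 j) = 0 by rewrite row_mxEr mxE.
have HA i j : augmented A B (lshift m i) (lshift m j) = A i j.
  by rewrite /augmented block_mxEul.
have HB i j : augmented A B (rshift n.+1 j) (lshift m i) = B i j.
  by rewrite /augmented block_mxEdl mxE.
split=> [i j|i j]; rewrite -?HA -?HB => star.
  by rewrite -!el; exact: supp.
by rewrite -el; exact: supp star (er j).
Qed.

Theorem lemma3 (R : realType) (n m k : nat)
    (A : structured n n) (B : structured n m)
    (hsym : symmetrically_structured A)
    (hrank : term_rank A = k)
    (hirr : irreducible A B) :
  exists V : 'rV[R]_(#|sym_free_pos A| + #|free_pos B|) -> Prop,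
    proper_variety V /\
    forall (At : 'M[R]_n) (Bt : 'M[R]_(n, m)),
      sym_realization A At -> realization B Bt ->
      ~ V (row_mx (entries_at (sym_free_pos A) At)
                  (entries_at (free_pos B) Bt)) ->
      has_nonzero_simple_controllable_modes At Bt k.
Proof.
case: n A B hsym hrank hirr => [|n] A B hsym hrank hirr.
  (* For [n = 0] the empty variety, cut out by the constant 1, works because [k = 0]. *)
  exists (fun=> False); split.
    split; last by move/(_ 0).
    exists [:: 1] => x; split=> // /(_ 1).
    by rewrite inE eqxx meval1 => /(_ isT)/eqP; rewrite oner_eq0.
  have /eqP k0 : k == 0%N.
    by rewrite -leqn0 -hrank (has_transversal_le (term_rank_transversal A)).
  by move=> At Bt _ _ _; exists [::]; rewrite k0.
pose GA := generic_state R A B; pose GB := generic_input R A B.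
pose GH := block_mx GA GB GB^T 0.
have Asurj M : sym_realization A M -> exists x, M = map_mx (meval x) GA.
  by move=> AM; exists (@parameters R n.+1 m A B M 0); rewrite generic_stateE.
have Hsurj M : sym_realization (augmented A B) M ->
    exists x, M = map_mx (meval x) GH.
  move=> /augmented_realizationP[At [Bt [AAt BBt ->]]].
  by exists (@parameters R n.+1 m A B At Bt); rewrite generic_augmentedE.
have [dA genA] := generic_krylov_maximal 1%:M Asurj.
have [dH genH] := @generic_krylov_maximal R _ (n + m) _ _ 1%:M Hsurj.
have /fin_all_exists[ds genS] s :=
  @generic_krylov_maximal R _ (n + m) _ _ (delta_mx s s) Hsurj.
have genR : generically (fun x => (k <= \rank (map_mx (meval x) GA))%N).
  have : has_transversal A k by rewrite -hrank; exact: term_rank_transversal.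
  case/(transversal_realization R hsym) => M /Asurj[x ->].
  exact: generic_rank.
(* Maximality of [At] makes its nonzero eigenvalues simple, maximality of the augmented matrix
   controls supports, and the rank bound supplies [k] eigenvalues. The zero set of the common
   polynomial [p] is the variety. *)
have [p [[x0 px0] genP]] := generically_and (generically_and genA genH)
  (generically_and (generically_forall genS) genR).
exists (fun v => p.@[v 0] = 0); split.
  split.
    exists [:: p] => x; split=> [px q|]; first by rewrite inE => /eqP ->.
    by apply; rewrite mem_head.
  move=> /(_ (\row_i x0 i)) /eqP; apply/negP.
  by rewrite (meval_eq (v2 := x0)) // => i; rewrite mxE.
move=> At Bt AAt BBt /eqP; rewrite -/(@parameters R n.+1 m A B At Bt).
case/genP => -[KA KH] [KS rkA]; rewrite /GH !generic_augmentedE // in KH KS.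
rewrite generic_stateE // in KA rkA.
have [|ls [uls szls lsP]] := @symmetric_simple_modes R _ At AAt.2.
  by move=> l lN0; exact: maximal_eigenspace hsym AAt KA lN0.
exists [seq l%:C%C | l <- ls]; split.
- by rewrite map_inj_uniq //; exact: complexI.
- rewrite size_map szls; apply/eqP; rewrite eqn_leq rkA -hrank.
  by rewrite rank_le_term_rank //; exact: AAt.1.
move=> _ /mapP[l /lsP[lN0 lsimple] ->]; split=> //.
  by rewrite -[0]/(0%:C%C) (inj_eq (@complexI _)).
move=> e [eN0 eA] eB; apply: hirr.
(* The eigenvalue is real, so the real and imaginary parts of [e] each satisfy the mode equations
   over [R]. *)
pose part (f : R[i] -> R) := map_mx f e^T.
have part_support f : f 0 = 0 -> {morph f : x y / x + y} ->
    (forall z x, f (z * x%:C%C) = f z * x) ->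
    (forall i j, A i j -> part f 0 i = 0 -> part f 0 j = 0) /\
    (forall i j, B i j -> part f 0 i = 0).
  move=> f0 fD fM.
  apply: (mode_support (l := l) hsym AAt BBt KS KH lN0);
    rewrite /part -map_mx_complexify //.
    by rewrite eA; apply/rowP => i; rewrite !mxE mulrC fM mulrC.
  by rewrite eB; apply/rowP => i; rewrite !mxE.
have ReM (z : R[i]) (x : R) : complex.Re (z * x%:C%C) = complex.Re z * x.
  by case: z => a b /=; rewrite mulr0 subr0.
have ImM (z : R[i]) (x : R) : complex.Im (z * x%:C%C) = complex.Im z * x.
  by case: z => a b /=; rewrite mulr0 add0r.
have ReD : {morph @complex.Re R : x y / x + y} by case=> a b [].
have ImD : {morph @complex.Im R : x y / x + y} by case=> a b [].
have [ReA ReB] := part_support (@complex.Re R) erefl ReD ReM.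
have [ImA ImB] := part_support (@complex.Im R) erefl ImD ImM.
have e0 i : e i 0 = 0 <->
    part (@complex.Re R) 0 i = 0 /\ part (@complex.Im R) 0 i = 0.
  rewrite !mxE; case: (e i 0) => a b /=.
  by split=> [[-> ->] //|[-> ->]].
(* The support of [e] is the block: a neighbour of a zero coordinate is zero, and so is every state
   fed by an input. *)
apply: (@closed_set_reducible _ _ _ _ [set i | e i 0 != 0]).
- apply: contra_neq eN0 => /setP T0; apply/colP => i; rewrite mxE.
  by apply/eqP; have := T0 i; rewrite !inE => /negbFE.
- move=> i j; rewrite !inE negbK => /eqP ei /eqP/e0[Rj Ij].
  apply/negP => Aij; apply: ei; apply/e0; rewrite hsym in Aij.
  by split; [exact: ReA Rj|exact: ImA Ij].
move=> i j; rewrite inE => /eqP ei; apply/negP => Bij; apply: ei; apply/e0.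
by split; [exact: ReB Bij|exact: ImB Bij].
Qed.
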